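(* Let $\mathcal{B}$ be a Schauder basis of $\mathbb{X}$ with basis constant $\mathbf K_b$, and let $\tau\in(0,1]$. Then for every $m\in\mathbb{N}\cup\{0\}$, $$g^{c}_{m,\tau}\ \le\ \mathbf K_b\,\mathbf L^{ch}_{m,\tau}\left(1+\mathbf L^{ch}_{m,\tau}+\mathbf L^{ch}_{m,\tau}\mathbf K_b\right).$$ Consequently, $$\mathbf L^{ch}_{m,\tau}\ \ge\ \frac{1}{\mathbf K_b}\left(\frac{g^c_{m,\tau}}{3}\right)^{1/2}.$$
   Context: Setting. $(\mathbb{X},\|\cdot\|)$ is an infinite-dimensional Banach space over $\mathbb{F}=\mathbb{R}$ or $\mathbb{C}$ with dual $(\mathbb{X}^*,\|\cdot\|_* )$. A (semi-normalized Markushevich) M-basis is a sequence $\mathcal{B}=(e_n)_{n=1}^\infty$ in $\mathbb{X}$ such that: (1) there is a unique collection $(e_n^* )_{n=1}^\infty\subset\mathbb{X}^*$ with $e_i^*(e_j)=\delta_{i,j}$; (2) $0<\inf_n\{\|e_n\|,\|e_n^*\|_*\}\le\sup_n\{\|e_n\|,\|e_n^*\|_*\}<\infty$; (3) $\mathbb{X}=\overline{\mathrm{span}\{e_n:n\in\mathbb{N}\}}$; (4) $\mathbb{X}^*=\overline{\mathrm{span}\{e_n^*:n\in\mathbb{N}\}}^{w^*}$. A Schauder basis is an M-basis for which the partial sum operators $S_m(x)=\sum_{n=1}^me_n^*(x)e_n$ satisfy $\mathbf K_b:=\sup_m\|S_m\|<\infty$; $\mathbf K_b$ is the basis constant. Notation.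 $\mathrm{supp}(x)=\{n:e_n^*(x)\ne0\}$ and $P_A(x)=\sum_{n\in A}e_n^*(x)e_n$ for finite $A\subset\mathbb{N}$. Weak greedy sets. A finite $\Lambda\subset\mathbb{N}$ is a $\tau$-weak greedy set of $x$ if $\min_{n\in\Lambda}|e_n^*(x)|\ge\tau\max_{n\notin\Lambda}|e_n^*(x)|$ (the empty set is always allowed). $\mathcal{G}(x,m,\tau)$ is the collection of all $\tau$-weak greedy sets of $x$ of cardinality $m$. For $m\in\mathbb{N}\cup\{0\}$, $g^c_{m,\tau}$ is the smallest $C\in[0,\infty]$ such that $\|x-P_\Lambda(x)\|\le C\|x\|$ for all $x\in\mathbb{X}$, all $0\le k\le m$ and all $\Lambda\in\mathcal{G}(x,k,\tau)$. Chebyshev parameter. A Chebyshev $\tau$-greedy operator of order $m$ is a map $CG_m^\tau:\mathbb{X}\to\mathbb{X}$ such that for every $x\in\mathbb{X}$ there is $\Lambda\in\mathcal{G}(x,m,\tau)$ with $\mathrm{supp}(CG_m^\tau(x))\subset\Lambda$ and $\|x-CG_m^\tau(x)\|=\min\{\|x-\sum_{n\in\Lambda}a_ne_n\|:(a_n)\subset\mathbb{F}\}$. Let $\sigma_m(x)=\inf\{\|x-\sum_{n\in A}a_ne_n\|:A\subset\mathbb{N},|A|\le m,(a_n)\subset\mathbb{F}\}$. $\mathbf L^{ch}_{m,\tau}$ is the smallest constant such that $\|x-CG_m^\tau(x)\|\le\mathbf L^{ch}_{m,\tau}\sigma_m(x)$ for all $x\in\mathbb{X}$ and all Chebyshev $\tau$-greedy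 operators $CG_m^\tau$ of order $m$. *)

(* Defs.v *)
From HB Require Import structures.
From mathcomp Require Import all_boot all_order all_algebra finmap.
From mathcomp Require Import complex.
From mathcomp Require Import all_classical all_reals all_analysis.

Set Implicit Arguments.
Unset Strict Implicit.
Unset Printing Implicit Defensive.

Import Order.TTheory GRing.Theory Num.Theory.
Import numFieldNormedType.Exports.

Local Open Scope fset_scope.
Local Open Scope classical_set_scope.
Local Open Scope ring_scope.

Variant scalar_field := RealScalars | ComplexScalars.

Definition rc_field (R : realType) (F : scalar_field) : numFieldType :=
  match F with RealScalars => R | ComplexScalars => R[i] end.

Definition to_real (R : realType) (F : scalar_field) : rc_field R F -> R :=
  match F with RealScalars => id | ComplexScalars => @complex.Re R end.

(* The library norm of a normed module over R[i] takes values in R[i] (it is a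
   nonnegative real there); [rnorm] is the same norm, valued in R. *)
Definition rnorm (R : realType) (F : scalar_field)
    (V : normedModType (rc_field R F)) (x : V) : R :=
  to_real `|x|.

Definition infinite_dimensional (K : numFieldType) (V : lmodType K) : Prop :=
  forall (n : nat) (v : 'I_n -> V),
    exists x : V, forall a : 'I_n -> K, x <> \sum_(i < n) a i *: v i.

Definition linear_span (K : numFieldType) (V : lmodType K) (v : nat -> V) :
    set V :=
  [set x | exists (n : nat) (a : nat -> K), x = \sum_(i < n) a i *: v i].

Definition opnorm (R : realType) (F : scalar_field)
    (V W : normedModType (rc_field R F)) (f : V -> W) : \bar R :=
  ereal_sup [set (rnorm (f x))%:E | x in [set x : V | rnorm x <= 1]].

Section Bases.
Context {R : realType} {F : scalar_field}.
Let K := rc_field R F.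
Context {X : completeNormedModType K}.

(* Sequences are indexed from 0: [e n] is the (n+1)-st basis vector. *)
Implicit Types (e : nat -> X) (es : nat -> {linear X -> K^o}).
Implicit Types (x : X) (tau : R) (m : nat) (A L : {fset nat}).

Definition biorthogonal e es : Prop :=
  forall i j : nat, es i (e j) = (i == j)%:R.

(* The norms of all the vectors and coordinate functionals of the basis. *)
Definition basis_norms e es : set (\bar R) :=
  [set (rnorm (e n))%:E | n in [set: nat]] `|`
  [set opnorm (es n) | n in [set: nat]].

(* The dual space consists of the continuous linear maps X -> K^o; its weak*
   topology is the trace of the topology of pointwise convergence. *)
Record Mbasis e es : Prop := {
  Mbasis_continuous : forall n, continuous (es n) ;
  Mbasis_biorthogonal : biorthogonal e es ;
  Mbasis_unique : forall fs : nat -> {linear X -> K^o},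
    (forall n, continuous (fs n)) -> biorthogonal e fs ->
    forall n x, fs n x = es n x ;
  Mbasis_inf : (0 < ereal_inf (basis_norms e es))%E ;
  Mbasis_sup : (ereal_sup (basis_norms e es) < +oo)%E ;
  Mbasis_dense : closure (linear_span e) = [set: X] ;
  Mbasis_wdense : forall f : {linear X -> K^o}, continuous f ->
    closure (linear_span (fun n => es n : X -> K^o) : set {ptws X -> K^o})
      (f : X -> K^o) }.

Definition partial_sum e es m x : X := \sum_(n < m) es n x *: e n.

Definition basis_constant e es : \bar R :=
  ereal_sup [set opnorm (partial_sum e es m) | m in [set m | (0 < m)%N]].

Definition schauder_basis e es : Prop :=
  Mbasis e es /\ (basis_constant e es < +oo)%E.

Definition supp es x : set nat := [set n | es n x <> 0].

Definition basis_proj e es A x : X := \sum_(n <- A) es n x *: e n.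

(* For [L] empty the infimum is +oo, so that the empty set is allowed. *)
Definition weak_greedy es tau x L : Prop :=
  (tau%:E * ereal_sup [set (rnorm (es n x))%:E | n in [set n | n \notin L]] <=
   ereal_inf [set (rnorm (es n x))%:E | n in [set n | n \in L]])%E.

Definition greedy_sets es x m tau : set {fset nat} :=
  [set L | #|` L| = m /\ weak_greedy es tau x L].

Definition greedy_const e es m tau : \bar R :=
  ereal_inf [set C : \bar R | (0 <= C)%E /\
    forall x (k : nat) L, (k <= m)%N -> greedy_sets es x k tau L ->
      ((rnorm (x - basis_proj e es L x))%:E <= C * (rnorm x)%:E)%E].

(* The distances from [x] to the linear combinations of (e n) for n in A. *)
Definition distances e x A : set R :=
  [set rnorm (x - \sum_(n <- A) a n *: e n) | a in [set: nat -> K]].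

Definition chebyshev_greedy_op e es m tau (CG : X -> X) : Prop :=
  forall x, exists2 L : {fset nat}, greedy_sets es x m tau L &
    [/\ supp es (CG x) `<=` [set n | n \in L],
        distances e x L (rnorm (x - CG x)) &
        lbound (distances e x L) (rnorm (x - CG x))].

Definition best_error e m x : R :=
  inf [set d | exists2 A : {fset nat}, (#|` A| <= m)%N & distances e x A d].

Definition chebyshev_const e es m tau : \bar R :=
  ereal_inf [set C : \bar R | (0 <= C)%E /\
    forall CG : X -> X, chebyshev_greedy_op e es m tau CG ->
    forall x, ((rnorm (x - CG x))%:E <= C * (best_error e m x)%:E)%E].

End Bases.

(* Main.v *)
Require Import Defs.
From HB Require Import structures.
From mathcomp Require Import all_boot all_order all_algebra finmap.
From mathcomp Require Import complex.
From mathcomp Require Import all_classical all_reals all_analysis.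
From mathcomp Require Import ring lra.

(* Let [A] be a [tau]-weak greedy set of [x], [#|A| <= m]; truncating by partial
   sums, take [x] supported in [0, N), and let
   [alpha = tau * max_(n < N, n notin A) |es n x|].  Take a block [B] of [m]
   indices from [N] on, split as [B2] followed by [B1] with [#|B1| = #|A|].
   - [B] is a greedy set of [x - P_A x + alpha 1_B], and the Chebyshev bound
     against the [m] indices of [A] and [B2], followed by a partial sum that
     erases [B], gives [|x - P_A x| <= Kb L |x + alpha 1_B1|].
   - [A] together with [B2] is a greedy set of [x + alpha 1_B]; comparing with
     the approximant [alpha 1_B] and keeping the tail that contains only [B1]
     gives [|alpha 1_B1| <= (1 + Kb) L |x|].
   The constant [L] is an infimum over all Chebyshev operators, so these bounds
   need an operator using a prescribed greedy set: greedy sets exist because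
   coordinates tend to 0, and best approximations from finite spans exist because
   adding one real direction at a time preserves attainment of the distance. *)

Set Implicit Arguments.
Unset Strict Implicit.
Unset Printing Implicit Defensive.

Import Order.TTheory GRing.Theory Num.Theory.
Import numFieldNormedType.Exports.

Local Open Scope ring_scope.
Local Open Scope ereal_scope.

(** * Real and complex scalars treated together, with a real-valued norm *)

Section Scalars.
Context {R : realType} {F : scalar_field}.
Local Notation K := (rc_field R F).
Local Open Scope ring_scope.

Definition of_real : R -> K :=
  match F with RealScalars => id | ComplexScalars => @real_complex R end.

(** The value 0 over the reals lets [scalar_decomp] hold in the same form for both fields. *)
Definition imag_unit : K :=
  match F with RealScalars => 0 | ComplexScalars => 'i%C end.

Lemma of_realD : {morph of_real : x y / x + y}.
Proof. by rewrite /of_real; case: F => //= x y; rewrite rmorphD. Qed.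

Lemma of_realM : {morph of_real : x y / x * y}.
Proof. by rewrite /of_real; case: F => //= x y; rewrite rmorphM. Qed.

Lemma of_real0 : of_real 0 = 0.
Proof. by rewrite /of_real; case: F => //=; rewrite rmorph0. Qed.

Lemma of_realN : {morph of_real : x / - x}.
Proof. by rewrite /of_real; case: F => //= x; rewrite rmorphN. Qed.

Lemma of_real1 : of_real 1 = 1.
Proof. by rewrite /of_real; case: F => //=; rewrite rmorph1. Qed.

Lemma of_realK : cancel of_real (@to_real R F).
Proof. by rewrite /of_real /to_real; case: F. Qed.

Lemma le_of_real x y : (of_real x <= of_real y) = (x <= y).
Proof. by rewrite /of_real; case: F => //=; rewrite lecR. Qed.

Lemma lt_of_real x y : (of_real x < of_real y) = (x < y).
Proof. by rewrite !lt_neqAle le_of_real (inj_eq (can_inj of_realK)). Qed.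

Lemma to_realK (z : K) : 0 <= z -> of_real (to_real z) = z.
Proof.
rewrite /of_real /to_real; move: z; case: F => //= -[a b] ab.
by have /= -> := ger0_Im ab.
Qed.

Lemma norm_of_real x : `|of_real x| = of_real `|x|.
Proof.
rewrite /of_real; case: F => //=.
by rewrite normc_def /= expr0n addr0 sqrtr_sqr.
Qed.

Lemma scalar_decomp (z : K) : exists s t, z = of_real s + of_real t * imag_unit.
Proof.
rewrite /of_real /imag_unit; move: z; case: F => /= [z|[a b]].
  by exists z, 0; rewrite mul0r addr0.
by exists a, b; apply/eqP; rewrite eq_complex /= !(mul0r, mulr0, mulr1, addr0, add0r, subr0) !eqxx.
Qed.

Context {V : normedModType K}.
Implicit Types x y : V.

Lemma rnormE x : of_real (rnorm x) = `|x|.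
Proof. by rewrite to_realK. Qed.

Lemma rnorm_ge0 x : 0 <= rnorm x.
Proof. by rewrite -le_of_real rnormE of_real0. Qed.

Lemma rnormD x y : rnorm (x + y) <= rnorm x + rnorm y.
Proof. by rewrite -le_of_real of_realD !rnormE ler_normD. Qed.

Lemma rnormN x : rnorm (- x) = rnorm x.
Proof. by rewrite /rnorm normrN. Qed.

Lemma rnormB x y : rnorm (x - y) <= rnorm x + rnorm y.
Proof. by rewrite -[leRHS](congr1 (+%R _) (rnormN y)) rnormD. Qed.

Lemma rnorm0 : rnorm (0 : V) = 0.
Proof. by rewrite /rnorm normr0 -of_real0 of_realK. Qed.

Lemma rnorm0_eq0 x : rnorm x = 0 -> x = 0.
Proof. by move=> x0; apply/normr0_eq0; rewrite -rnormE x0 of_real0. Qed.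

Lemma rnorm_gt0 x : x != 0 -> 0 < rnorm x.
Proof.
move=> x0; rewrite lt_def rnorm_ge0 andbT.
by apply: contra_neq x0 => /rnorm0_eq0.
Qed.

Lemma rnormZ (a : K) x : rnorm (a *: x) = rnorm (a : K^o) * rnorm x.
Proof.
by rewrite -[RHS]of_realK of_realM rnormE /rnorm to_realK // normrZ.
Qed.

Lemma rnorm_of_real (t : R) : rnorm (of_real t : K^o) = `|t|.
Proof. by rewrite /rnorm norm_of_real of_realK. Qed.

Lemma rnormZr (t : R) x : rnorm (of_real t *: x) = `|t| * rnorm x.
Proof. by rewrite rnormZ rnorm_of_real. Qed.

End Scalars.

(** * Attained distances to real subspaces *)

Section Proximinal.
Context {R : realType} {F : scalar_field}.
Context {V : normedModType (rc_field R F)}.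
Local Open Scope ring_scope.
Local Open Scope classical_set_scope.

(** Only real scalars are required, so that a complex line can be added as two real lines, each
    handled by minimizing over one real variable. *)
Definition real_subspace (W : set V) :=
  [/\ W 0, forall x y, W x -> W y -> W (x + y) &
      forall (t : R) x, W x -> W (of_real t *: x)].

Definition proximinal (W : set V) :=
  forall x, exists2 y, W y & forall z, W z -> rnorm (x - y) <= rnorm (x - z).

Definition add_line (W : set V) (v : V) : set V :=
  [set y + of_real t *: v | y in W & t in [set: R]].

Lemma add_lineP (W : set V) v z :
  add_line W v z <-> exists y t, W y /\ z = y + of_real t *: v.
Proof.
by split=> [[y Wy [t _ <-]]|[y [t [Wy ->]]]]; [exists y, t|exists y => //; exists t].
Qed.

Lemma real_subspaceB (W : set V) x y :
  real_subspace W -> W x -> W y -> W (x - y).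
Proof.
move=> [_ WD WZ] Wx Wy; apply: WD => //.
have -> : - y = of_real (-1) *: y by rewrite of_realN of_real1 scaleN1r.
exact: WZ.
Qed.

Lemma real_subspace_add_line (W : set V) v :
  real_subspace W -> real_subspace (add_line W v).
Proof.
move=> [W0 WD WZ]; split.
- by apply/add_lineP; exists 0, 0; rewrite of_real0 scale0r addr0.
- move=> _ _ /add_lineP[y [t [Wy ->]]] /add_lineP[z [s [Wz ->]]].
  apply/add_lineP; exists (y + z), (t + s); split; first exact: WD.
  by rewrite of_realD scalerDl addrACA.
- move=> s _ /add_lineP[y [t [Wy ->]]].
  apply/add_lineP; exists (of_real s *: y), (s * t); split; first exact: WZ.
  by rewrite of_realM scalerDr scalerA.
Qed.

Lemma lipschitz_continuous (f : R -> R) (c : R) :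
  (forall s t, `|f s - f t| <= c * `|s - t|) -> continuous f.
Proof.
move=> fc t; apply/cvgrPdist_le => /= eps eps0.
have c0 : 0 < `|c| + 1 by rewrite ltr_wpDl.
near=> s; apply: (le_trans (fc _ _)).
apply: (@le_trans _ _ ((`|c| + 1) * `|t - s|)).
  by apply: ler_wpM2r => //; rewrite (le_trans (ler_norm c)) // lerDl.
rewrite -ler_pdivlMl //; near: s.
by apply: cvgr_dist_le; rewrite ?mulr_gt0 ?invr_gt0 //; exact: cvg_id.
Unshelve. all: by end_near. Qed.

(** The extreme value theorem gives a minimum on [[- T, T]], at most [f 0]; outside, [|t| * d] is at
    least [2 * |f 0|], so coercivity gives [f 0 <= f t]. *)
Lemma coercive_attains_min (f : R -> R) (c d : R) : 0 < d ->
  (forall s t, `|f s - f t| <= c * `|s - t|) ->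
  (forall t, `|t| * d - f 0 <= f t) ->
  exists t0, forall t, f t0 <= f t.
Proof.
move=> d0 flip fcoer; pose T := 2 * `|f 0| / d.
have T0 : 0 <= T by rewrite /T divr_ge0 ?mulr_ge0 // ltW.
have [||t0 _ t0min] := @EVT_min R f (- T) T.
- by lra.
- exact/continuous_subspaceT/lipschitz_continuous.
exists t0 => t; have [tT|] := boolP (t \in `[- T, T]%R); first exact: t0min.
rewrite in_itv/= -ler_norml -ltNge => /ltW Tt.
have f0 : f t0 <= f 0 by apply: t0min; rewrite in_itv/= oppr_le0 T0.
apply: (le_trans f0); apply: le_trans (fcoer t).
have : 2 * `|f 0| <= `|t| * d by rewrite -ler_pdivrMr.
by have := ler_norm (f 0); lra.
Qed.

(* If [v] is at positive distance from [W], the distance from [x - t v] to [W]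
   is Lipschitz and coercive in [t]; if that distance is zero, [v] lies in [W]. *)
Lemma proximinal_add_line (W : set V) v :
  real_subspace W -> proximinal W -> proximinal (add_line W v).
Proof.
move=> Wsub Wprox x; have [W0 WD WZ] := Wsub.
have /choice[p pP] : forall u, exists y, W y /\
    forall z, W z -> rnorm (u - y) <= rnorm (u - z).
  by move=> u; have [y Wy ymin] := Wprox u; exists y.
have Wp u : W (p u) by have [] := pP u.
pose d u := rnorm (u - p u).
have dmin u z : W z -> d u <= rnorm (u - z) by have [_] := pP u; exact.
have dD u w : d (u + w) <= d u + rnorm w.
  apply: (le_trans (dmin _ _ (Wp u))).
  by rewrite addrAC; exact: rnormD.
have [dv0|dvn0] := eqVneq (d v) 0.
  have Wv : W v by move/rnorm0_eq0/eqP: dv0; rewrite subr_eq0 => /eqP ->.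
  exists (p x) => [|_ /add_lineP[y [t [Wy ->]]]].
    by apply/add_lineP; exists (p x), 0; rewrite of_real0 scale0r addr0.
  by apply: dmin; apply: WD => //; exact: WZ.
have dv : 0 < d v by rewrite lt_def dvn0 rnorm_ge0.
pose f (t : R) := d (x - of_real t *: v).
have flip1 (s t : R) : f s - f t <= rnorm v * `|s - t|.
  rewrite lerBlDl /f.
  have -> : x - of_real s *: v = (x - of_real t *: v) + of_real (t - s) *: v.
    by rewrite of_realD of_realN scalerDl scaleNr addrA subrK.
  by rewrite (le_trans (dD _ _)) // rnormZr mulrC distrC.
have flip (s t : R) : `|f s - f t| <= rnorm v * `|s - t|.
  by rewrite ler_norml flip1 andbT lerNl opprB distrC flip1.
have fcoer (t : R) : `|t| * d v - f 0 <= f t.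
  rewrite lerBlDr; have [->|t0] := eqVneq t 0.
    by rewrite normr0 mul0r addr_ge0 // rnorm_ge0.
  (* Up to sign, [t v - w] is the difference of the residuals of [x - t v] and of [x], whose norms
     are [f t] and [f 0]. *)
  pose w := (p x - p (x - of_real t *: v)).
  have Ww : W w by exact: real_subspaceB.
  have dvw : `|t| * d v <= rnorm (of_real t *: (v - of_real t^-1 *: w)).
    by rewrite rnormZr ler_wpM2l // dmin //; exact: WZ.
  apply: (le_trans dvw); rewrite scalerBr scalerA -of_realM mulfV //.
  rewrite of_real1 scale1r -rnormN opprB.
  rewrite {2}/f of_real0 scale0r subr0.
  rewrite /f /d; set u := p (x - _).
  have -> : w - of_real t *: v = (x - of_real t *: v - u) - (x - p x).
    by rewrite /w -/u opprB [RHS]addrC -[x - _ - u]addrA addrA subrK [- _ - u]addrC addrA.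
  exact: rnormB.
have [t0 t0min] := coercive_attains_min dv flip fcoer.
exists (p (x - of_real t0 *: v) + of_real t0 *: v).
  by apply/add_lineP; exists (p (x - of_real t0 *: v)), t0.
move=> _ /add_lineP[y [t [Wy ->]]].
have -> : x - (y + of_real t *: v) = (x - of_real t *: v) - y.
  by rewrite opprD addrA addrAC.
have -> a : x - (a + of_real t0 *: v) = (x - of_real t0 *: v) - a.
  by rewrite opprD addrA addrAC.
exact: le_trans (t0min t) (dmin _ _ Wy).
Qed.
End Proximinal.

(** * Best approximation from finite spans, and operator norms *)

Section FiniteSpan.
Context {R : realType} {F : scalar_field}.
Local Notation K := (rc_field R F).
Context {V : normedModType K} (e : nat -> V).
Local Open Scope ring_scope.
Local Open Scope classical_set_scope.

Definition finite_span (s : seq nat) : set V :=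
  [set \sum_(n <- s) a n *: e n | a in [set: nat -> K]].

(** The coefficient of [e n] splits into real and imaginary parts; over the reals the second line is
    spanned by 0. *)
Lemma finite_span_cons n s : n \notin s ->
  finite_span (n :: s) =
  add_line (add_line (finite_span s) (e n)) (imag_unit *: e n).
Proof.
move=> ns; apply/seteqP; split=> [_ [a _ <-]|_ /add_lineP[_ [t [/add_lineP[_ [u [[a _ <-] ->]]] ->]]]].
  have [u [t anE]] := scalar_decomp (a n).
  apply/add_lineP; exists (\sum_(k <- s) a k *: e k + of_real u *: e n), t.
  split; first by apply/add_lineP; exists (\sum_(k <- s) a k *: e k), u; split=> //; exists a.
  by rewrite big_cons anE scalerDl -scalerA addrC addrA.
exists (fun k => if k == n then of_real u + of_real t * imag_unit else a k) => //.
rewrite big_cons eqxx addrC scalerDl -scalerA -addrA; congr (_ + _).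
rewrite big_seq [RHS]big_seq; apply: eq_bigr => k ks.
by case: eqP => // kn; rewrite -kn ks in ns.
Qed.

Lemma finite_span_proximinal s : uniq s ->
  real_subspace (finite_span s) /\ proximinal (finite_span s).
Proof.
elim: s => [_|n s IHs /= /andP[ns us]].
  have nilE z : finite_span [::] z <-> z = 0.
    by split=> [[a _ <-]|->]; [rewrite big_nil|exists (fun=> 0); rewrite ?big_nil].
  split; first split; rewrite ?nilE //.
  - by move=> x y; rewrite !nilE => -> ->; rewrite addr0.
  - by move=> t x; rewrite !nilE => ->; rewrite scaler0.
  - by move=> x; exists 0 => [|z]; rewrite nilE // => ->.
have [sub prox] := IHs us.
rewrite finite_span_cons //; split; first exact/real_subspace_add_line/real_subspace_add_line.
by apply: proximinal_add_line; [exact: real_subspace_add_line|exact: proximinal_add_line].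
Qed.

(** Rescale [x] to norm 1. Homogeneity is all that is asked of [f], so the plain function
    [partial_sum e es N] qualifies. *)
Lemma opnorm_bound (W : normedModType K) (f : V -> W) (c : R) (x : V) :
  (forall a u, f (a *: u) = a *: f u) -> (opnorm f <= c%:E)%E ->
  rnorm (f x) <= c * rnorm x.
Proof.
move=> fZ fc; have [->|x0] := eqVneq x 0.
  by have := fZ 0 0; rewrite !scale0r => ->; rewrite !rnorm0 mulr0.
have nx := rnorm_gt0 x0.
have : ((rnorm (f (of_real (rnorm x)^-1 *: x)))%:E <= c%:E)%E.
  apply: le_trans fc; apply: ereal_sup_ubound; eexists => //=.
  by rewrite rnormZr ger0_norm ?invr_ge0 ?rnorm_ge0 // mulVf ?gt_eqF.
rewrite lee_fin fZ rnormZr ger0_norm ?invr_ge0 ?rnorm_ge0 //.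
by rewrite mulrC ler_pdivrMr.
Qed.

End FiniteSpan.

(** * Coordinates, greedy sets and the Chebyshev constant *)

Section Basis.
Context {R : realType} {F : scalar_field}.
Local Notation K := (rc_field R F).
Context {X : completeNormedModType K}.
Context {e : nat -> X} {es : nat -> {linear X -> K^o}}.
Local Open Scope ring_scope.
Local Open Scope classical_set_scope.
Implicit Types (x z : X) (s : seq nat) (A L : {fset nat}) (tau : R).

Lemma coordinate_sum k s (a : nat -> K) : biorthogonal e es -> uniq s ->
  es k (\sum_(n <- s) a n *: e n) = if k \in s then a k else 0.
Proof.
move=> bi us; rewrite linear_sum /=.
under eq_bigr => n _ do rewrite linearZ /= bi.
case: ifP => ks.
  rewrite (bigD1_seq k) //= eqxx big1 ?addr0; first by rewrite /GRing.scale/= mulr1.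
  by move=> n nk; rewrite eq_sym (negbTE nk) scaler0.
rewrite big_seq big1 // => n ns.
by case: eqP => [kn|_]; [rewrite kn ns in ks|rewrite scaler0].
Qed.

Lemma coordinate_bound : Mbasis e es ->
  exists2 M : R, 0 < M & forall n x, rnorm (es n x : K^o) <= M * rnorm x.
Proof.
move=> He; have := Mbasis_sup He; set S := ereal_sup _ => Soo.
have Sge n : (opnorm (es n) <= S)%E by apply: ereal_sup_ubound; right; exists n.
exists (`|fine S| + 1) => [|n x]; first by rewrite ltr_wpDl.
apply: opnorm_bound => [a u|]; first by rewrite linearZ.
apply: (le_trans (Sge n)); move: Soo {Sge}; case: S => [r||] //= _; last by rewrite leNye.
by rewrite lee_fin (le_trans (ler_norm r)) // lerDl.
Qed.

Lemma span_approx x (eps : R) : Mbasis e es -> 0 < eps ->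
  exists n (a : nat -> K), rnorm (x - \sum_(i < n) a i *: e i) < eps.
Proof.
move=> He eps0.
have eps0' : 0 < (of_real eps : K).
  by rewrite -of_real0 lt_of_real.
have : closure (linear_span e) x by rewrite (Mbasis_dense He).
move=> /(_ _ (nbhsx_ballx x _ eps0')) [_ [[n [a ->]]]].
by rewrite -ball_normE /= => xy; exists n, a; rewrite -(@lt_of_real R F) rnormE.
Qed.

(** Far coordinates vanish on a finite combination close to [x], and coordinate functionals are
    uniformly bounded. *)
Lemma coordinate_small x (eps : R) : Mbasis e es -> 0 < eps ->
  exists N, forall n, (N <= n)%N -> rnorm (es n x : K^o) <= eps.
Proof.
move=> He eps0; have [M M0 esM] := coordinate_bound He.
have [N [a xN]] := span_approx x He (divr_gt0 eps0 M0).
exists N => n Nn.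
have -> : es n x = es n (x - \sum_(i < N) a i *: e i).
  rewrite linearB /= -(big_mkord xpredT (fun i => a i *: e i)) coordinate_sum ?iota_uniq //.
    by rewrite mem_index_iota ltnNge Nn subr0.
  exact: Mbasis_biorthogonal.
by rewrite (le_trans (esM _ _)) // -ler_pdivlMl // mulrC ltW.
Qed.

Lemma weak_greedyP tau x L : 0 < tau ->
  weak_greedy es tau x L <->
  forall i j, i \in L -> j \notin L ->
    tau * rnorm (es j x : K^o) <= rnorm (es i x : K^o).
Proof.
move=> tau0; rewrite /weak_greedy; split=> [gr i j iL jL|gr].
  rewrite -lee_fin EFinM.
  apply: (@le_trans _ _ (ereal_inf [set (rnorm (es n x : K^o))%:E | n in [set n | n \in L]])).
    apply: le_trans gr; apply: lee_wpmul2l; first by rewrite lee_fin ltW.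
    by apply: ereal_sup_ubound; exists j.
  by apply: ereal_inf_lbound; exists i.
apply/ereal_infP => _ [i iL <-].
rewrite -[leRHS](_ : tau%:E * (rnorm (es i x : K^o) / tau)%:E = _)%E; last first.
  by rewrite -EFinM mulrC divfK // gt_eqF.
apply: lee_wpmul2l; first by rewrite lee_fin ltW.
apply: ge_ereal_sup => _ [j /= jL <-].
by rewrite lee_fin ler_pdivlMr // mulrC gr.
Qed.

(** Induction on [m]: adjoin an index of largest coefficient among those outside [L]. *)
Lemma greedy_set_exists x m : Mbasis e es ->
  exists2 L, #|` L| = m & forall i j, i \in L -> j \notin L ->
    rnorm (es j x : K^o) <= rnorm (es i x : K^o).
Proof.
move=> He; elim: m => [|m [L Lm Lgr]].
  by exists fset0 => [|i j]; rewrite ?cardfs0 // in_fset0.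
suff [i iL imax] : exists2 i, i \notin L &
    forall j, j \notin L -> rnorm (es j x : K^o) <= rnorm (es i x : K^o).
  exists (i |` L)%fset; first by rewrite cardfsU1 iL Lm.
  move=> k j; rewrite !inE negb_or => /orP[/eqP ->|kL] /andP[_ jL]; first exact: imax.
  exact: Lgr.
pose c i := rnorm (es i x : K^o).
(* If all coefficients outside the finite set [L] vanish, any index outside it will do. *)
have [[i iL ci]|allz] := pselect (exists2 i, i \notin L & 0 < c i); last first.
  have [i iL] : exists i, i \notin L.
    exists (\max_(i <- L) i).+1; apply/negP => /leq_bigmax_seq.
    by move=> /(_ xpredT id isT); rewrite ltnn.
  exists i => // j jL; apply: le_trans (rnorm_ge0 _).
  by rewrite leNgt; apply/negP => cj; apply: allz; exists j.
(* From [N] on, coefficients are at most [c i], so a maximum over the finite range up to [maxn N i],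
   which contains [i], is a maximum outside [L]. *)
have [N Nsmall] := coordinate_small x He ci.
have iN : (i < (maxn N i).+1)%N by rewrite ltnS leq_maxr.
have [k kL kmax] := @Order.TotalTheory.arg_maxP _ _ _ (Ordinal iN) (fun k => val k \notin L) (fun k => c (val k)) iL.
exists (val k) => // j jL.
have [jN|Nj] := ltnP j (maxn N i).+1; first exact: (kmax (Ordinal jN)).
apply: le_trans (kmax (Ordinal iN) iL); apply: Nsmall.
by rewrite (leq_trans (leq_maxl N i)) // ltnW.
Qed.

(** The operator uses [L] at [z] and, elsewhere, a set from [greedy_set_exists], which is weakly
    greedy because [tau <= 1]. The clause [x = z -> A = L] carries this prescription through the
    choice. *)
Lemma chebyshev_op_through tau m z L : Mbasis e es -> 0 < tau <= 1 ->
  greedy_sets es z m tau L ->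
  exists2 CG, chebyshev_greedy_op e es m tau CG &
    exists b : nat -> K, CG z = \sum_(n <- L) b n *: e n.
Proof.
move=> He /andP[tau0 tau1] Lz; have bi := Mbasis_biorthogonal He.
have /choice[CG CGP] : forall x, exists y, exists2 A : {fset nat},
    greedy_sets es x m tau A /\ (x = z -> A = L) & exists2 b : nat -> K,
    y = \sum_(n <- A) b n *: e n &
    lbound (distances e x A) (rnorm (x - y)).
  move=> x.
  have [A Ax Az] : exists2 A, greedy_sets es x m tau A & x = z -> A = L.
    have [->|xz] := pselect (x = z); first by exists L.
    have [A Am Agr] := greedy_set_exists x m He.
    exists A => //; split=> //; apply/weak_greedyP => // i j iA jA.
    by rewrite (le_trans _ (Agr _ _ iA jA)) // ler_piMl // rnorm_ge0.
  have [_ /(_ x)[_ [b _ <-] bmin]] := @finite_span_proximinal _ _ _ e A (fset_uniq A).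
  exists (\sum_(n <- A) b n *: e n), A => //; exists b => // _ [a _ <-].
  by apply: bmin; exists a.
exists CG.
  move=> x; have [A [Ax _] [b CGx bmin]] := CGP x; exists A => //; split=> //.
    move=> n; rewrite /supp /= CGx coordinate_sum ?fset_uniq //.
    by case: ifP.
  by exists b; rewrite ?CGx.
by have [A [_ ->//] [b CGz _]] := CGP z; exists b.
Qed.

Lemma best_error_le m x A (a : nat -> K) : (#|` A| <= m)%N ->
  best_error e m x <= rnorm (x - \sum_(n <- A) a n *: e n).
Proof.
move=> Am; apply: ge_inf; last by exists A => //; exists a.
by exists 0 => _ [B _ [b _ <-]]; exact: rnorm_ge0.
Qed.

Lemma best_error_ge0 m x : 0 <= best_error e m x.
Proof.
apply: lb_le_inf => [|_ [B _ [b _ <-]]]; last exact: rnorm_ge0.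
exists (rnorm (x - \sum_(n <- fset0) (fun=> 0) n *: e n)).
by exists fset0; [rewrite cardfs0|exists (fun=> 0)].
Qed.

Lemma chebyshev_const_ge0 m tau : (0 <= chebyshev_const e es m tau)%E.
Proof. by apply/ereal_infP => C []. Qed.

(** The infimum is itself admissible: admissible constants come arbitrarily close to [r]. *)
Lemma chebyshev_constP m tau (r : R) CG x :
  chebyshev_const e es m tau = r%:E -> chebyshev_greedy_op e es m tau CG ->
  rnorm (x - CG x) <= r * best_error e m x.
Proof.
move=> rE CGP; have sig0 := best_error_ge0 m x.
apply/ler_addgt0Pr => eps eps0.
(* The [+ 1] keeps the denominator positive when the best error is 0. *)
have del0 : 0 < eps / (best_error e m x + 1) by rewrite divr_gt0 // ltr_wpDl.
have := @lb_ereal_inf_adherent _ [set C : \bar R | (0 <= C)%E /\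
    forall CG : X -> X, chebyshev_greedy_op e es m tau CG ->
    forall x, ((rnorm (x - CG x))%:E <= C * (best_error e m x)%:E)%E] _ del0.
rewrite -/(chebyshev_const e es m tau) rE => /(_ isT)[C [C0 /(_ _ CGP x) Cx] Clt].
rewrite -lee_fin; apply: (le_trans Cx).
apply: (@le_trans _ _ ((r + eps / (best_error e m x + 1))%:E * (best_error e m x)%:E)%E).
  by apply: lee_wpmul2r; rewrite ?lee_fin // ltW.
rewrite -EFinM lee_fin mulrDl lerD2l -mulrA ler_piMr // ?(ltW eps0) //.
by rewrite mulrC ler_pdivrMr ?mul1r ?lerDl // ltr_wpDl.
Qed.

(** The form in which the Chebyshev constant is applied: the greedy set [L] and the competitor are
    both free to choose. *)
Lemma chebyshev_le m tau (r : R) z L A (a : nat -> K) :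
  Mbasis e es -> 0 < tau <= 1 -> chebyshev_const e es m tau = r%:E ->
  #|` L| = m -> weak_greedy es tau z L -> (#|` A| <= m)%N ->
  exists b : nat -> K, rnorm (z - \sum_(n <- L) b n *: e n) <=
    r * rnorm (z - \sum_(n <- A) a n *: e n).
Proof.
move=> He tau01 rE Lm Lz Am.
have [CG CGP [b CGz]] := chebyshev_op_through He tau01 (conj Lm Lz).
exists b; rewrite -CGz (le_trans (chebyshev_constP z rE CGP)) //.
apply: ler_wpM2l (best_error_le _ _ Am).
by rewrite -lee_fin -rE chebyshev_const_ge0.
Qed.

(** A Chebyshev approximant is an [m]-term approximant, so its error is at least the best one; it
    remains to find a vector with positive best error. *)
Lemma chebyshev_const_ge1 m tau : Mbasis e es -> 0 < tau <= 1 ->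
  (1 <= chebyshev_const e es m tau)%E.
Proof.
move=> He tau01; have bi := Mbasis_biorthogonal He.
have [M M0 esM] := coordinate_bound He.
have := chebyshev_const_ge0 m tau.
case rE: (chebyshev_const e es m tau) => [r| |] // _; last by rewrite leey.
(* With [m.+1] unit coefficients, any [m] indices miss one, and that coordinate keeps the error at
   least [M^-1]. *)
pose z := \sum_(n <- iota 0 m.+1) (1 : K) *: e n.
have sig : 0 < best_error e m z.
  apply: (@lt_le_trans _ _ M^-1); first by rewrite invr_gt0.
  apply: lb_le_inf => [|_ [A Am [a _ <-]]].
    exists (rnorm (z - \sum_(n <- fset0) (fun=> 0) n *: e n)).
    by exists fset0; [rewrite cardfs0|exists (fun=> 0)].
  have [n nm nA] : exists2 n, (n \in iota 0 m.+1) & n \notin A.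
    apply: contrapT => nex.
    have : (size (iota 0 m.+1) <= #|` A|)%N.
      apply: uniq_leq_size (iota_uniq _ _) _ => n nm.
      by apply/negPn/negP => nA; apply: nex; exists n.
    by rewrite size_iota => /leq_trans /(_ Am); rewrite ltnn.
  rewrite -(ler_pM2l M0) mulfV ?gt_eqF // (le_trans _ (esM n _)) //.
  rewrite linearB /= !coordinate_sum ?iota_uniq ?fset_uniq // nm (negbTE nA) subr0.
  by rewrite -(@of_real1 R F) rnorm_of_real normr1.
have [L Lm Lgr] := greedy_set_exists z m He.
have Lw : weak_greedy es tau z L.
  have /andP[tau0 tau1] := tau01.
  apply/weak_greedyP => // i j iA jA.
  by rewrite (le_trans _ (Lgr _ _ iA jA)) // ler_piMl // rnorm_ge0.
have [CG CGP [b CGz]] := chebyshev_op_through He tau01 (conj Lm Lw).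
have := chebyshev_constP z rE CGP.
rewrite lee_fin CGz => rle; rewrite -(ler_pM2r sig) mul1r.
by apply: le_trans rle; apply: best_error_le; rewrite Lm.
Qed.

End Basis.

(** * Finite combinations and partial sums *)

Section PartialSums.
Context {R : realType} {F : scalar_field}.
Local Notation K := (rc_field R F).
Context {X : completeNormedModType K}.
Context {e : nat -> X} {es : nat -> {linear X -> K^o}}.
Local Open Scope ring_scope.
Local Open Scope classical_set_scope.
Implicit Types (x : X) (A L : {fset nat}) (tau k r : R) (c : nat -> K).

(** Sums over sets and shorter ranges are padded with zeros to a common range, so that vector
    identities reduce to a case analysis on one index. *)
Definition combination (M : nat) c : X := \sum_(n <- iota 0 M) c n *: e n.

Lemma eq_combination M c c' : (forall n, (n < M)%N -> c n = c' n) ->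
  combination M c = combination M c'.
Proof.
move=> cc'; rewrite /combination big_seq [RHS]big_seq.
by apply: eq_bigr => n; rewrite mem_iota => /cc' ->.
Qed.

Lemma combinationD M c c' :
  combination M c + combination M c' = combination M (fun n => c n + c' n).
Proof.
by rewrite /combination -big_split /=; apply: eq_bigr => n _; rewrite scalerDl.
Qed.

Lemma combinationB M c c' :
  combination M c - combination M c' = combination M (fun n => c n - c' n).
Proof.
by rewrite /combination -sumrB /=; apply: eq_bigr => n _; rewrite scalerBl.
Qed.

Lemma sum_fset_combination M A c : (forall n, n \in A -> (n < M)%N) ->
  \sum_(n <- A) c n *: e n = combination M (fun n => if n \in A then c n else 0).
Proof.
move=> AM; rewrite /combination.
transitivity (\sum_(n <- iota 0 M | n \in A) c n *: e n); last first.
  by rewrite big_mkcond; apply: eq_bigr => n _; case: ifP; rewrite ?scale0r.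
rewrite -[RHS]big_filter; apply: perm_big; apply: uniq_perm.
- exact: fset_uniq.
- by rewrite filter_uniq ?iota_uniq.
- move=> n; rewrite mem_filter mem_iota /= add0n.
  by case: (boolP (n \in A)) => // /AM ->.
Qed.

Lemma combination_widen N M c : (N <= M)%N ->
  combination N c = combination M (fun n => if (n < N)%N then c n else 0).
Proof.
move=> NM; rewrite /combination -{1}(subnKC NM) iotaD big_cat /= add0n.
rewrite [X in _ + X]big_seq [X in _ + X]big1 ?addr0 => [|n].
  rewrite big_seq [RHS]big_seq; apply: eq_bigr => n.
  by rewrite mem_iota /= add0n => ->.
by rewrite mem_iota => /andP[Nn _]; rewrite ltnNge Nn scale0r.
Qed.

Lemma coordinate_combination j M c : biorthogonal e es ->
  es j (combination M c) = if (j < M)%N then c j else 0.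
Proof. by move=> bi; rewrite /combination coordinate_sum ?iota_uniq // mem_iota. Qed.

Lemma partial_sumE N x : partial_sum e es N x = combination N (fun n => es n x).
Proof.
by rewrite /partial_sum -(big_mkord xpredT (fun n => es n x *: e n)) /index_iota subn0.
Qed.

Lemma partial_sumB N x y :
  partial_sum e es N (x - y) = partial_sum e es N x - partial_sum e es N y.
Proof.
rewrite /partial_sum -sumrB; apply: eq_bigr => n _.
by rewrite linearB scalerBl.
Qed.

Lemma partial_sumZ N a x :
  partial_sum e es N (a *: x) = a *: partial_sum e es N x.
Proof.
rewrite /partial_sum scaler_sumr; apply: eq_bigr => n _.
by rewrite linearZ scalerA.
Qed.

Lemma partial_sum_combination N M c : biorthogonal e es -> (N <= M)%N ->
  partial_sum e es N (combination M c) = combination N c.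
Proof.
move=> bi NM; rewrite partial_sumE; apply: eq_combination => n nN.
by rewrite coordinate_combination // (leq_trans nN NM).
Qed.

(** The first partial sum fixes [e 0], which is nonzero. *)
Lemma basis_constant_ge1 : biorthogonal e es -> (1 <= basis_constant e es)%E.
Proof.
move=> bi; have : (opnorm (partial_sum e es 1) <= basis_constant e es)%E.
  by apply: ereal_sup_ubound; exists 1%N.
case: (basis_constant e es) => [k| |]; last 2 first.
- by rewrite !leey.
- have : (0%:E <= opnorm (partial_sum e es 1))%E.
    by apply: ereal_sup_ubound; exists 0; rewrite /= ?rnorm0 // /partial_sum big_ord1 linear0 scale0r rnorm0.
  by move=> /le_trans /[apply].
have e0 : e 0%N != 0.
  apply/eqP => e0; have := bi 0%N 0%N; rewrite e0 linear0 eqxx => /eqP.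
  by rewrite eq_sym oner_eq0.
move=> /(opnorm_bound (e 0%N) (partial_sumZ 1)).
rewrite /partial_sum big_ord1 bi eqxx scale1r lee_fin.
by rewrite -{1}[rnorm _]mul1r ler_pM2r // rnorm_gt0.
Qed.

Lemma partial_sum_bound N k x : biorthogonal e es ->
  basis_constant e es = k%:E -> rnorm (partial_sum e es N x) <= k * rnorm x.
Proof.
(* [basis_constant] ranges over positive orders only; the sum of order 0 vanishes. *)
move=> bi kE; case: N => [|N].
  rewrite /partial_sum big_ord0 rnorm0 mulr_ge0 ?rnorm_ge0 //.
  by have := basis_constant_ge1 bi; rewrite kE lee_fin; exact: le_trans.
apply: opnorm_bound; first exact: partial_sumZ.
by rewrite -kE; apply: ereal_sup_ubound; exists N.+1.
Qed.

(** Partial sums of large order fix a finite combination [y] near [x], so the error at [x] equals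
    that at [x - y], at most [(1 + k) * rnorm (x - y)]. *)
Lemma partial_sum_approx k x (eps : R) N0 : Mbasis e es ->
  basis_constant e es = k%:E -> 0 < eps ->
  exists2 N, (N0 <= N)%N & rnorm (x - partial_sum e es N x) <= eps.
Proof.
move=> He kE eps0; have bi := Mbasis_biorthogonal He.
have k1 : 1 <= k by have := basis_constant_ge1 bi; rewrite kE.
have k10 : 0 < 1 + k by rewrite ltr_wpDr // (le_trans _ k1).
have [n [a xa]] := span_approx x He (divr_gt0 eps0 k10).
set y := \sum_(i < n) _ in xa.
exists (maxn n N0); first exact: leq_maxr.
have yE : y = combination n a.
  by rewrite /y -(big_mkord xpredT (fun i => a i *: e i)) /index_iota subn0.
have Sy : partial_sum e es (maxn n N0) y = y.
  rewrite partial_sumE yE [RHS](combination_widen _ (leq_maxl n N0)).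
  by apply: eq_combination => i _; rewrite coordinate_combination.
have -> : x - partial_sum e es (maxn n N0) x =
          (x - y) - partial_sum e es (maxn n N0) (x - y).
  by rewrite partial_sumB Sy opprB addrA subrK.
rewrite (le_trans (rnormB _ _)) //.
have := partial_sum_bound (maxn n N0) (x - y) bi kE.
have : (1 + k) * rnorm (x - y) <= eps by rewrite mulrC -ler_pdivlMr // ltW.
by rewrite mulrDl mul1r; lra.
Qed.

Lemma card_fset_iota i n : #|` [fset j in iota i n]%fset| = n.
Proof. by rewrite card_fseq undup_id ?iota_uniq // size_iota. Qed.

(** * The two Chebyshev comparisons, for finitely supported vectors *)

Section CoreEstimate.
Context (tau k r alpha : R) (m N : nat) (A : {fset nat}) (c : nat -> K).
Hypotheses (He : Mbasis e es) (tau01 : 0 < tau <= 1).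
Hypotheses (kE : basis_constant e es = k%:E).
Hypotheses (rE : chebyshev_const e es m tau = r%:E).
Hypotheses (AN : forall n, n \in A -> (n < N)%N) (Am : (#|` A| <= m)%N).
Hypotheses (alpha0 : 0 <= alpha).
Hypotheses (cA : forall n, n \in A -> alpha <= rnorm (c n : K^o)).
Hypotheses (cNA : forall n, (n < N)%N -> n \notin A ->
  tau * rnorm (c n : K^o) <= alpha).

(** The cut between the two sub-blocks: [B2] fills [[N, p)] and completes [A] to exactly [m]
    indices. *)
Let p := (N + (m - #|` A|))%N.
Let M := (N + m)%N.
Let B : {fset nat} := [fset n in iota N m]%fset.
Let B2 : {fset nat} := [fset n in iota N (m - #|` A|)]%fset.
Let aK : K := of_real alpha.

(* The block of constant coefficients [alpha] on [p, M), of the size of [A]. *)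
Let u := combination M (fun n => if (p <= n)%N then aK else 0).
Let y := combination N c.

Let NM : (N <= M)%N. Proof. exact: leq_addr. Qed.

Let pM : (p <= M)%N. Proof. by rewrite /p /M leq_add2l leq_subr. Qed.

Let Np : (N <= p)%N. Proof. exact: leq_addr. Qed.

Let bi : biorthogonal e es. Proof. exact: Mbasis_biorthogonal. Qed.

Let mem_B n : (n \in B) = (N <= n < M)%N.
Proof. by rewrite !inE mem_iota. Qed.

Let mem_B2 n : (n \in B2) = (N <= n < p)%N.
Proof. by rewrite !inE mem_iota. Qed.

Let mem_AB2 n : (n \in (A `|` B2)%fset) = (n \in A) || (N <= n < p)%N.
Proof. by rewrite in_fsetU mem_B2. Qed.

Let AB2M n : n \in (A `|` B2)%fset -> (n < M)%N.
Proof.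
rewrite mem_AB2 => /orP[/AN nN|/andP[_ np]]; first exact: leq_trans NM.
exact: leq_trans pM.
Qed.

Let BM n : n \in B -> (n < M)%N.
Proof. by rewrite mem_B => /andP[]. Qed.

Let card_AB2 : #|` (A `|` B2)%fset| = m.
Proof.
rewrite cardfsU [X in (_ - X)%N](_ : _ = 0%N); last first.
  apply/eqP; rewrite cardfs_eq0; apply/eqP/fsetP => n.
  rewrite in_fsetI mem_B2 in_fset0; apply/negP => /and3P[/AN nN Nn _].
  by rewrite ltnNge Nn in nN.
by rewrite subn0 /B2 card_fset_iota subnKC.
Qed.

Let rnorm_aK : rnorm (aK : K^o) = alpha.
Proof. by rewrite rnorm_of_real ger0_norm. Qed.

Lemma greedy_tail_bound :
  rnorm (combination N (fun n => if n \in A then 0 else c n)) <=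
  k * (r * rnorm (y + u)).
Proof.
have k1 : 1 <= k by have := basis_constant_ge1 bi; rewrite kE.
(* On [[0, M)] these are the coefficients of [y] with [A] removed and the whole block [B] added. *)
pose zc n : K := if (n < N)%N then (if n \in A then 0 else c n) else aK.
have Bgr : weak_greedy es tau (combination M zc) B.
  apply/weak_greedyP => [|i j]; first by case/andP: tau01.
  rewrite !mem_B !coordinate_combination // => /andP[Ni iM] jB.
  have -> : zc i = aK by rewrite /zc ltnNge Ni.
  rewrite iM rnorm_aK.
  case: ifP => jM; last by rewrite rnorm0 mulr0.
  have jN : (j < N)%N by rewrite ltnNge; apply: contra jB => ->.
  rewrite /zc jN; case: ifP => [_|/negbT jA]; first by rewrite rnorm0 mulr0.
  exact: cNA.
(* Subtracting this competitor restores [c] on [A] and cancels [B2], which leaves [y + u]. *)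
pose ac n : K := if n \in A then - c n else aK.
have [b] := chebyshev_le ac He tau01 rE (card_fset_iota N m) Bgr (eq_leq card_AB2).
rewrite (sum_fset_combination _ AB2M) (sum_fset_combination _ BM) !combinationB.
rewrite [X in _ <= _ * rnorm X](_ : _ = y + u); last first.
  rewrite /y /u (combination_widen _ NM) combinationD; apply: eq_combination => n nM.
  rewrite /zc /ac mem_AB2; have [nN|Nn] := ltnP n N.
    rewrite [(p <= n)%N]leqNgt (leq_trans nN Np) /= orbF addr0.
    by case: ifP; rewrite ?sub0r ?opprK ?subr0.
  have -> : (n \in A) = false by apply/negP => /AN; rewrite ltnNge Nn.
  by rewrite /= ltnNge; case: (leqP p n); rewrite /= ?subr0 ?subrr add0r.
set v := combination M _ => vle.
(* [B] lies beyond [N], so the unknown coefficients [b] are cut off. *)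
have <- : partial_sum e es N v = combination N (fun n => if n \in A then 0 else c n).
  rewrite partial_sum_combination //; apply: eq_combination => n nN.
  by rewrite mem_B leqNgt nN /= subr0 /zc nN.
rewrite (le_trans (partial_sum_bound _ _ bi kE)) // ler_wpM2l //.
by rewrite (le_trans _ k1).
Qed.

Lemma block_bound : rnorm u <= (1 + k) * (r * rnorm y).
Proof.
have k1 : 1 <= k by have := basis_constant_ge1 bi; rewrite kE.
pose wc n : K := if (n < N)%N then c n else aK.
(* The value [alpha] separates: coefficients on [A] and [B2] are at least [alpha], and [tau] times
   any other is at most [alpha], on the rest of [B] because [tau <= 1]. *)
have ABgr : weak_greedy es tau (combination M wc) (A `|` B2)%fset.
  have /andP[tau0 tau1] := tau01.
  apply/weak_greedyP => // i j iAB; rewrite !coordinate_combination // (AB2M iAB) => jAB.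
  apply: (@le_trans _ _ alpha); last first.
    rewrite /wc; case: ltnP => iN; last by rewrite rnorm_aK.
    move: iAB; rewrite mem_AB2 leqNgt iN orbF; exact: cA.
  case: ifP => jM; last by rewrite rnorm0 mulr0.
  rewrite /wc; case: ltnP => jN; last by rewrite rnorm_aK ler_piMl.
  by apply: cNA => //; apply: contra jAB; rewrite mem_AB2 => ->.
have [b] := chebyshev_le (fun=> aK) He tau01 rE card_AB2 ABgr (eq_leq (card_fset_iota N m)).
rewrite (sum_fset_combination _ AB2M) (sum_fset_combination _ BM) !combinationB.
rewrite [X in _ <= _ * rnorm X](_ : _ = y); last first.
  rewrite /y (combination_widen _ NM); apply: eq_combination => n nM.
  rewrite /wc mem_B nM; case: ltnP => /= _; first by rewrite subr0.
  by rewrite subrr.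
set v := combination M _ => vle.
(* [A] and [B2] lie below [p], so from [p] on the coefficients of [v] are still [alpha]. *)
have -> : u = v - partial_sum e es p v.
  rewrite partial_sum_combination // (combination_widen _ pM) combinationB.
  apply: eq_combination => n nM; rewrite mem_AB2.
  case: leqP => pn; last by rewrite subrr.
  rewrite andbF orbF subr0.
  have nN : (n < N)%N = false by rewrite ltnNge (leq_trans Np pn).
  have -> : (n \in A) = false by apply/negP => /AN; rewrite nN.
  by rewrite subr0 /wc nN.
rewrite (le_trans (rnormB _ _)) // mulrDl mul1r lerD //.
rewrite (le_trans (partial_sum_bound _ _ bi kE)) // ler_wpM2l //.
by rewrite (le_trans _ k1).
Qed.

(** The last factor comes from the triangle inequality for [y + u]: 1 from [y] and [(1 + k) * r]
    from [u]. *)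
Lemma greedy_core_estimate :
  rnorm (combination N (fun n => if n \in A then 0 else c n)) <=
  k * r * (1 + r + r * k) * rnorm (combination N c).
Proof.
have k1 : 1 <= k by have := basis_constant_ge1 bi; rewrite kE.
have r1 : 1 <= r by have := @chebyshev_const_ge1 _ _ _ e es m _ He tau01; rewrite rE.
have k0 : 0 <= k by lra.
have r0 : 0 <= r by lra.
apply: (le_trans greedy_tail_bound).
rewrite -/y -!mulrA; apply: ler_wpM2l => //; apply: ler_wpM2l => //.
rewrite (le_trans (rnormD _ _)) //.
have := block_bound; set ny := rnorm y => ub.
by rewrite -addrA mulrDl mul1r lerD2l (le_trans ub) // [leLHS](_ : _ = (r + r * k) * ny) //; ring.
Qed.

End CoreEstimate.

(** The truncation error counts once directly and [C] times through the core estimate, hence the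
    tolerance [eps / (1 + C)]. *)
Lemma greedy_estimate tau k r m A x : Mbasis e es -> 0 < tau <= 1 ->
  basis_constant e es = k%:E -> chebyshev_const e es m tau = r%:E ->
  (#|` A| <= m)%N -> weak_greedy es tau x A ->
  rnorm (x - basis_proj e es A x) <= k * r * (1 + r + r * k) * rnorm x.
Proof.
move=> He tau01 kE rE Am Agr; have bi := Mbasis_biorthogonal He.
set C := k * r * _.
have C0 : 0 <= C.
  have : 1 <= k by have := basis_constant_ge1 bi; rewrite kE.
  have : 1 <= r by have := @chebyshev_const_ge1 _ _ _ e es m _ He tau01; rewrite rE.
  by move=> r1 k1; rewrite /C !(mulr_ge0, addr_ge0) //; lra.
have C10 : 0 < 1 + C by rewrite ltr_pwDl.
apply/ler_addgt0Pr => eps eps0.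
have AN n : n \in A -> (n < (\max_(n <- A) n).+1)%N.
  by move=> nA; rewrite ltnS; apply: (leq_bigmax_seq (F := id)).
have [N NA xN] := partial_sum_approx x (\max_(n <- A) n).+1 He kE (divr_gt0 eps0 C10).
have {NA}AN n : n \in A -> (n < N)%N by move=> /AN /leq_trans; apply.
have /andP[tau0 tau1] := tau01.
have Agr' := (weak_greedyP x A tau0).1 Agr.
(* The default 0 covers the case where [A] contains every index below [N]. *)
pose alpha := \big[Num.max/0]_(n <- iota 0 N | n \notin A) (tau * rnorm (es n x : K^o)).
have a0 : 0 <= alpha by apply: bigmax_ge_id.
have aA n : n \in A -> alpha <= rnorm (es n x : K^o).
  by move=> nA; apply: bigmax_le => [|j jA]; [exact: rnorm_ge0|exact: Agr'].
have aNA n : (n < N)%N -> n \notin A -> tau * rnorm (es n x : K^o) <= alpha.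
  by move=> nN nA; apply: (@bigmax_sup_seq _ _ _ _ _ n); rewrite ?mem_iota.
have := greedy_core_estimate He tau01 kE rE AN Am a0 aA aNA; rewrite -/C.
rewrite -partial_sumE.
have -> : combination N (fun n => if n \in A then 0 else es n x) =
    partial_sum e es N x - basis_proj e es A x.
  rewrite partial_sumE /basis_proj (sum_fset_combination _ AN) combinationB.
  by apply: eq_combination => n _; case: ifP; rewrite ?subrr ?subr0.
move=> core.
have -> : x - basis_proj e es A x = (x - partial_sum e es N x) +
    (partial_sum e es N x - basis_proj e es A x) by rewrite addrA subrK.
rewrite (le_trans (rnormD _ _)) //.
(* Bounding by [k * rnorm x] instead would cost another factor [k]. *)
have Sx : rnorm (partial_sum e es N x) <= rnorm x + rnorm (x - partial_sum e es N x).
  by rewrite -{1}[partial_sum _ _ _ _](subKr x) rnormB.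
have := ler_wpM2l C0 Sx.
have : (1 + C) * rnorm (x - partial_sum e es N x) <= eps.
  by rewrite mulrC -ler_pdivlMr.
by rewrite mulrDl mulrDr mul1r; lra.
Qed.

End PartialSums.

(** * The inequalities between the extended-real constants *)

Theorem theorem1p5 (R : realType) (F : scalar_field)
    (X : completeNormedModType (rc_field R F))
    (e : nat -> X) (es : nat -> {linear X -> (rc_field R F)^o})
    (tau : R) (m : nat)
    (Xinf : infinite_dimensional X)
    (He : schauder_basis e es)
    (Htau : (0 < tau <= 1)%R) :
  let Kb := basis_constant e es in
  let g := greedy_const e es m tau in
  let L := chebyshev_const e es m tau in
  g <= Kb * L * (1 + L + L * Kb) /\ Kb^-1 * sqrte (g / 3%:E) <= L.
Proof.
move=> Kb g L; have [Hm Koo] := He; have bi := Mbasis_biorthogonal Hm.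
have K1 : 1 <= Kb := basis_constant_ge1 bi.
have L1 : 1 <= L := chebyshev_const_ge1 m Hm Htau.
have [k kE] : exists k, basis_constant e es = k%:E.
  by move: Koo K1; rewrite /Kb; case: (basis_constant e es) => // k; exists k.
rewrite /Kb kE in K1 *.
(* When [L] is infinite, both upper bounds are [+oo], since the basis constant is positive. *)
case rE : L L1 => [r||] // L1; last first.
  rewrite leey; split=> //.
  have k0 : 0 < k%:E by exact: lt_le_trans K1.
  by rewrite gt0_mulye // !addey // [k%:E * _]gt0_muley // mulyy leey.
rewrite !lee_fin in K1 L1.
have gC : g <= (k * r * (1 + r + r * k))%:E.
  apply: ereal_inf_lbound; split=> [|x n A nm [An Agr]].
    by rewrite lee_fin !(mulr_ge0, addr_ge0) //; lra.
  rewrite -EFinM lee_fin; apply: (greedy_estimate (m := m)) (Agr) => //.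
  by rewrite An.
split; first exact: gC.
have k0 : (0 < k)%R by lra.
rewrite !inver !gt_eqF //.
(* Cancelling [k^-1] and squaring leaves [g / 3 <= (k * r) ^ 2]. *)
have -> : r%:E = (k^-1)%:E * (k * r)%:E.
  by rewrite -EFinM mulKf // gt_eqF.
apply: lee_wpmul2l; first by rewrite lee_fin invr_ge0 ltW.
have -> : (k * r)%:E = sqrte ((k * r)%:E ^+ 2).
  by rewrite sqrte_sqr gee0_abs // lee_fin mulr_ge0 //; lra.
rewrite lee_sqrt; last by rewrite expe2 -EFinM lee_fin mulr_ge0 // mulr_ge0 //; lra.
apply: (@le_trans _ _ ((k * r * (1 + r + r * k))%:E * (3^-1)%:E)).
  by apply: lee_wpmul2r.
rewrite expe2 -!EFinM lee_fin ler_pdivrMr // -[leRHS]mulrA ler_wpM2l //.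
  by rewrite mulr_ge0 //; lra.
(* Each of the terms 1, [r] and [r * k] is at most [r * k], whence the constant 3. *)
have : (r * 1 <= r * k)%R by apply: ler_wpM2l; lra.
by nra.
Qed.
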